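(* Let $n\in\mathbb{N}\setminus\{1,2\}$ (that is, $n\ge 3$) and let $C_a:=C_{1,a_2,a_3,\dots,a_n}$ be the caterpillar tree with $n+1+\sum_{k=2}^n a_k$ vertices, where $a_k>1$ for $k\in\{2,\dots,n\}$, obtained from a path with consecutive vertices $1,2,\dots,n$ by attaching one leaf to vertex $1$ and $a_k$ leaves to vertex $k$ for each $k\in\{2,\dots,n\}$. Let $\mathcal{A}(C_a)$ and $\mathcal{A}_{RW}(C_a)$ be the evolution algebras associated to $C_a$ and to the symmetric random walk on $C_a$, respectively. Then $\mathcal{A}(C_a)\ncong\mathcal{A}_{RW}(C_a)$. Moreover, the only homomorphism between $\mathcal{A}(C_a)$ and $\mathcal{A}_{RW}(C_a)$ is the null map.
   Context: Algebras are over a field $\mathbb{K}$. Let $G=(V,E)$ be a finite simple connected graph with adjacency matrix $A=(a_{ij})_{i,j\in V}$; let $\deg(i)=\sum_{k}a_{ik}$. The evolution algebra $\mathcal{A}(G)$ associated to $G$ is the algebra with basis $\{e_i\}_{i\in V}$ and bilinear product determined by $e_i\cdot e_i=\sum_{k\in V}a_{ik}e_k$ and $e_i\cdot e_j=0$ for $i\ne j$. The evolution algebra $\mathcal{A}_{RW}(G)$ associated to the symmetric random walk on $G$ is the algebra with basis $\{e_i\}_{i\in V}$ and bilinear product determined by $e_i\cdot e_i=\sum_{k\in V}\frac{a_{ik}}{\deg(i)}e_k$ and $e_i\cdot e_j=0$ for $i\neq j$. An algebra homomorphism is a $\mathbb{K}$-linear map $f$ with $f(xy)=f(x)f(y)$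 for all $x,y$; an isomorphism (written $\cong$) is a bijective homomorphism. The null map is the map sending everything to $0$.
   Formalization: Degrees are assumed nonzero in the field so the random-walk algebra is defined; the claim that only the null map is a homomorphism (false e.g. over the complex numbers) is stated only when, for each k from 2 to n, a sum of a_k squares vanishes only trivially. *)

(* Defs.v *)
From HB Require Import structures.
From mathcomp Require Import all_boot all_order all_algebra.

Set Implicit Arguments.
Unset Strict Implicit.
Unset Printing Implicit Defensive.

Import GRing.Theory.

(* Not-necessarily-associative algebras, without unit. *)
Record algebra (K : fieldType) := Algebra {
  carrier :> lmodType K;
  amul : carrier -> carrier -> carrier;
  amul_linearr : forall x, linear (amul x);
  amul_linearl : forall y, linear (amul^~ y) }.

Definition alg_hom (K : fieldType) (A B : algebra K) (f : {linear A -> B}) :=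
  forall x y : A, f (amul x y) = amul (f x) (f y).

Definition isomorphic (K : fieldType) (A B : algebra K) :=
  exists f : {linear A -> B}, alg_hom f /\ bijective f.

Section EvolutionAlgebra.
Local Open Scope ring_scope.
Variables (K : fieldType) (T : finType) (c : T -> T -> K).

(* [ffun i => x i] stands for the formal combination \sum_i x i *: e_i *)
Definition evol_mul (x y : {ffun T -> K^o}) : {ffun T -> K^o} :=
  [ffun k => \sum_i x i * y i * c i k].

Fact evol_mul_linearr x : linear (evol_mul x).
Proof.
move=> a y z; apply/ffunP => k; rewrite !ffunE /GRing.scale /= mulr_sumr.
rewrite -big_split /=; apply: eq_bigr => i _; rewrite !ffunE /GRing.scale /=.
by rewrite mulrDr mulrDl mulrCA !mulrA.
Qed.

Fact evol_mul_linearl y : linear (evol_mul^~ y).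
Proof.
move=> a x z; apply/ffunP => k; rewrite !ffunE /GRing.scale /= mulr_sumr.
rewrite -big_split /=; apply: eq_bigr => i _; rewrite !ffunE /GRing.scale /=.
by rewrite !mulrDl !mulrA.
Qed.

Definition evol_alg : algebra K := Algebra evol_mul_linearr evol_mul_linearl.

Definition evol_basis (i : T) : evol_alg := [ffun j => (j == i)%:R].

Lemma evol_mul_basis_neq i j :
  i != j -> amul (evol_basis i) (evol_basis j) = 0.
Proof.
move=> nij; apply/ffunP => k; rewrite !ffunE big1 // => l _; rewrite !ffunE.
by case: eqP => [->|_]; rewrite ?(negPf nij) ?mulr0 ?mul0r.
Qed.

Lemma evol_mul_basis_sq i :
  amul (evol_basis i) (evol_basis i) = \sum_k c i k *: evol_basis k.
Proof.
apply/ffunP => k; rewrite sum_ffunE ffunE (bigD1 i) //= !ffunE eqxx !mul1r.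
rewrite big1 => [|l nl]; last by rewrite !ffunE (negPf nl) !mul0r.
rewrite addr0 (bigD1 k) //= !ffunE eqxx /GRing.scale /= mulr1.
rewrite big1 ?addr0 // => l nl.
by rewrite !ffunE eq_sym (negPf nl) /GRing.scale /= mulr0.
Qed.

Lemma evol_basis_decomp (x : evol_alg) :
  x = \sum_i (x : {ffun T -> K^o}) i *: evol_basis i.
Proof.
apply/ffunP => k; rewrite sum_ffunE (bigD1 k) //= !ffunE eqxx.
rewrite /GRing.scale /= mulr1 big1 ?addr0 // => l nl.
by rewrite !ffunE eq_sym (negPf nl) /GRing.scale /= mulr0.
Qed.

End EvolutionAlgebra.

Record sgraph := SGraph {
  vertex :> finType;
  adj : rel vertex;
  adj_sym : symmetric adj;
  adj_irr : irreflexive adj;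
  adj_conn : forall x y, connect adj x y }.

Definition deg (G : sgraph) (i : G) : nat := \sum_(k : G) adj i k.

Section GraphAlgebras.
Local Open Scope ring_scope.
Variables (K : fieldType) (G : sgraph).

Definition graph_alg : algebra K :=
  @evol_alg K G (fun i k => (adj i k)%:R).

Definition rw_alg : algebra K :=
  @evol_alg K G (fun i k => (adj i k)%:R / (deg i)%:R).

End GraphAlgebras.

Section Caterpillar.
Variables (n : nat) (a : nat -> nat).

Definition nleaves (k : nat) : nat := if k == 1 then 1 else a k.

(* [inl i] is the path vertex i.+1; [inr (Tagged _ l)] with [l] over [i] is a
   leaf attached to it.  Only the values of [a] on 2, ..., n are used. *)
Definition cat_vertex : finType := ('I_n + {i : 'I_n & 'I_(nleaves i.+1)})%type.

Definition cat_adj (u v : cat_vertex) : bool :=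
  match u, v with
  | inl i, inl j => (i.+1 == j) || (j.+1 == i)
  | inl i, inr l | inr l, inl i => tag l == i
  | inr _, inr _ => false
  end.

Fact cat_adj_sym : symmetric cat_adj.
Proof. by case=> [i|l] [j|m] //=; rewrite orbC. Qed.

Fact cat_adj_irr : irreflexive cat_adj.
Proof. by case=> [i|l] //=; rewrite eqn_leq ltnn. Qed.

Fact cat_adj_conn u v : connect cat_adj u v.
Proof.
have sc : connect_sym cat_adj by apply: sym_connect_sym; apply: cat_adj_sym.
have path_conn (i j : 'I_n) : connect cat_adj (inl i) (inl j).
  wlog le_ij : i j / i <= j.
    by move=> H; case: (leqP i j) => [/H//|/ltnW/H]; rewrite sc.
  case: j le_ij => m; elim: m => [|m IH] ltm /=.
    by rewrite leqn0 => /eqP i0; apply: eq_connect0; congr inl; apply: val_inj.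
  rewrite leq_eqVlt => /orP[/eqP im|].
    by apply: eq_connect0; congr inl; apply: val_inj.
  rewrite ltnS => /(IH (ltnW ltm)) /connect_trans; apply; apply: connect1.
  by rewrite /= eqxx.
pose foot (w : cat_vertex) := match w with inl i => i | inr l => tag l end.
have footP w : connect cat_adj w (inl (foot w)).
  by case: w => [i|l]; [apply: connect0 | apply: connect1; rewrite /= eqxx].
apply: connect_trans (footP u) _; apply: connect_trans (path_conn _ (foot v)) _.
by rewrite sc.
Qed.

Definition caterpillar : sgraph :=
  SGraph cat_adj_sym cat_adj_irr cat_adj_conn.

Lemma card_caterpillar :
  0 < n -> #|caterpillar| = n + 1 + \sum_(2 <= k < n.+1) a k.
Proof.
move=> n_gt0; rewrite card_sum card_ord card_tagged sumnE big_map big_enum /=.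
rewrite -addnA; congr (_ + _).
under eq_bigr do rewrite card_ord.
rewrite -(big_mkord xpredT (fun i => nleaves i.+1)) big_ltn //=; congr (_ + _).
rewrite [RHS]big_add1 /=; apply: eq_big_nat => -[//|i] _; by [].
Qed.

End Caterpillar.

(* Over a field without this property for some [a k], 2 <= k <= n, the
   caterpillar algebras have nonzero homomorphisms, e.g. from graph_alg to
   rw_alg: take u <> 0 supported on the leaves at k with sum of squared
   coordinates 0, so that u * u = 0; send two leaves at k to u and -u and all
   other basis vectors to 0.  It holds for all m over a formally real field. *)
Definition sum_squares_anisotropic (K : fieldType) (m : nat) : Prop :=
  forall x : 'I_m -> K,
    (\sum_i x i ^+ 2 = 0)%R -> forall i, x i = 0%R.

(* Main.v *)
Require Import Defs.
From HB Require Import structures.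
From mathcomp Require Import all_boot all_order all_algebra.

Set Implicit Arguments.
Unset Strict Implicit.
Unset Printing Implicit Defensive.

Import GRing.Theory.
Local Open Scope ring_scope.

(* Let f be a homomorphism between two evolution algebras of the caterpillar
   and X_u = f(e_u).  The X_u are pairwise orthogonal; since every path vertex
   carries a leaf, at most one X_u has a nonzero coordinate at a given path
   vertex.  If f is bijective, comparing squares shows that the X_u with u a
   leaf vanish on the path and that f permutes the lines spanned by the path
   vertices.  The number of leaves at vertex 1 forces X_1 = lambda e_1, and then
   X_2 = nu e_2.  The relations e_u^2 = sum of the neighbours at 1, 2 and their
   leaves give nu^2 = lambda, w_2 = 1 and a_2 (1 - w_1) = 0, where w_u is the
   weight of u in the target.  With w_u = 1 / deg u this reads a_2 + 2 = 1 and
   a_2 / 2 = 0, a contradiction.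

   Under the anisotropy hypothesis x x = 0 implies x = 0.  Then X_u = 0
   propagates along edges, and nonzero pairwise orthogonal X_u are linearly
   independent, so every nonzero homomorphism is an isomorphism. *)

(** * Coordinates in an evolution algebra *)

Section Coordinates.
Variables (K : fieldType) (T : finType) (c : T -> T -> K).

Definition coord (x : evol_alg c) (u : T) : K := (x : {ffun T -> K^o}) u.

Lemma coordP (x y : evol_alg c) : coord x =1 coord y -> x = y.
Proof. by move=> xy; apply/ffunP => u; apply: xy. Qed.

Lemma coord0 u : coord 0 u = 0.
Proof. by rewrite /coord ffunE. Qed.

Lemma coordZ b x u : coord (b *: x) u = b * coord x u.
Proof. by rewrite /coord ffunE. Qed.

Lemma coord_sum I r (P : pred I) (F : I -> evol_alg c) u :
  coord (\sum_(i <- r | P i) F i) u = \sum_(i <- r | P i) coord (F i) u.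
Proof. by rewrite /coord sum_ffunE. Qed.

Lemma coordM x y k : coord (amul x y) k = \sum_u coord x u * coord y u * c u k.
Proof. by rewrite /coord ffunE. Qed.

Lemma coord_basis u v : coord (evol_basis c u) v = (v == u)%:R.
Proof. by rewrite /coord ffunE. Qed.

Lemma evol_basis_neq0 u : evol_basis c u != 0.
Proof.
apply/eqP => /(congr1 (coord^~ u)); rewrite coord_basis coord0 eqxx.
by move/eqP; rewrite oner_eq0.
Qed.

Lemma neq0_coord x : x != 0 -> exists u, coord x u != 0.
Proof.
move=> xn0; apply/existsP; apply: contraNT xn0 => /existsPn x0.
by apply/eqP/coordP => u; rewrite coord0; apply/eqP; rewrite -[_ == _]negbK.
Qed.

Lemma coord_sqr_single x u k :
  (forall v, v != u -> coord x v = 0) ->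
  coord (amul x x) k = coord x u ^+ 2 * c u k.
Proof.
move=> x0; rewrite coordM (bigD1 u) //= big1 ?addr0 // => v /x0 ->.
by rewrite !mul0r.
Qed.

End Coordinates.

(** * Neighbour sums and degrees in the caterpillar *)

Section CaterpillarSums.
Variables (n : nat) (a : nat -> nat).
Notation G := (caterpillar n a).

Definition leaf (i : 'I_n) (j : 'I_(nleaves a i.+1)) : G :=
  inr (Tagged (fun i : 'I_n => 'I_(nleaves a i.+1)) j).

Definition spine (i : 'I_n) : G := inl i.

Lemma spine_inj : injective spine. Proof. by move=> i j []. Qed.

Lemma leaf_inj i : injective (@leaf i).
Proof. by move=> j k [] /eqP; rewrite eq_Tagged => /eqP. Qed.

Lemma big_caterpillar (R : nmodType) (F : G -> R) :
  \sum_u F u = \sum_i F (spine i) + \sum_i \sum_j F (@leaf i j).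
Proof.
rewrite big_sumType /= sig_big_dep /=; congr (_ + _).
by apply: eq_bigr => -[i j] _.
Qed.

Lemma nleaves_gt1 :
  (forall k, (2 <= k <= n)%N -> (1 < a k)%N) ->
  forall i : 'I_n, i != 0%N :> nat -> (1 < nleaves a i.+1)%N.
Proof.
by move=> a_gt1 i i0; rewrite /nleaves eqSS (negPf i0) a_gt1 // ltnS lt0n i0 /=.
Qed.

Lemma nleaves_gt0 :
  (forall k, (2 <= k <= n)%N -> (1 < a k)%N) ->
  forall i : 'I_n, (0 < nleaves a i.+1)%N.
Proof.
move=> a_gt1 i; case: (eqVneq (i : nat) 0%N) => [-> //|i0].
exact: ltnW (nleaves_gt1 a_gt1 i0).
Qed.

Lemma vertexP (P : G -> Prop) :
  (forall i, P (spine i)) -> (forall i j, P (@leaf i j)) -> forall u, P u.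
Proof. by move=> Ps Pl [i|[i j]]; [apply: Ps|apply: Pl]. Qed.

Lemma sum_adj_leaf (R : pzRingType) (F : G -> R) i j :
  \sum_u (adj u (@leaf i j))%:R * F u = F (spine i).
Proof.
rewrite big_caterpillar [X in _ + X]big1 ?addr0 => [|k _]; last first.
  by rewrite big1 // => m _; rewrite mul0r.
rewrite (bigD1 i) //= eqxx mul1r big1 ?addr0 // => k ki.
by rewrite eq_sym (negPf ki) mul0r.
Qed.

Lemma sum_adj_spine (R : pzRingType) (F : G -> R) i :
  \sum_u (adj u (spine i))%:R * F u =
  \sum_k (adj (spine k) (spine i))%:R * F (spine k) + \sum_j F (@leaf i j).
Proof.
rewrite big_caterpillar; congr (_ + _).
rewrite (bigD1 i) //= [X in _ + X]big1 ?addr0 => [|k ki]; last first.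
  by rewrite big1 // => m _; rewrite (negPf ki) mul0r.
by apply: eq_bigr => j _; rewrite eqxx mul1r.
Qed.

Lemma deg_leaf i j : deg (@leaf i j) = 1%N.
Proof.
(* The neighbour sums are stated over a ring, so the degree is computed in [int]. *)
apply/eqP; rewrite -eqz_nat /deg -natz natr_sum; apply/eqP.
under eq_bigr do rewrite adj_sym -[_%:R]mulr1.
exact: (sum_adj_leaf (fun=> 1)).
Qed.

Lemma deg_spine i :
  deg (spine i) = (\sum_k adj (spine k) (spine i) + nleaves a i.+1)%N.
Proof.
apply/eqP; rewrite -eqz_nat /deg -natz natr_sum; apply/eqP.
under eq_bigr do rewrite adj_sym -[_%:R]mulr1.
rewrite (sum_adj_spine (fun=> 1)) sumr_const card_ord PoszD; congr (_ + _).
  by rewrite -natz natr_sum; apply: eq_bigr => k _; rewrite mulr1.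
by rewrite natz.
Qed.

End CaterpillarSums.

(** * Products for vertex weights [w]: 1 for the graph, [1 / deg] for the random walk *)

Section WeightedProduct.
Variables (K : fieldType) (n : nat) (a : nat -> nat).
Notation G := (caterpillar n a).
Variables (w : G -> K) (c : G -> G -> K).
Hypothesis cE : forall u v, c u v = (adj u v)%:R * w u.
Hypothesis w_neq0 : forall u, w u != 0.
Hypothesis w_leaf : forall i j, w (@leaf n a i j) = 1.
Hypothesis nleaves_gt0 : forall i : 'I_n, (0 < nleaves a i.+1)%N.

Lemma coord_mul_leaf (x y : evol_alg c) i j :
  coord (amul x y) (@leaf n a i j) =
  coord x (spine a i) * coord y (spine a i) * w (spine a i).
Proof.
rewrite coordM -(sum_adj_leaf (fun u => coord x u * coord y u * w u) j).
by apply: eq_bigr => u _; rewrite cE mulrCA.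
Qed.

(** The hypothesis removes the path neighbours of [i]; what remains is the standard bilinear form on
    the leaves at [i], all of weight 1. *)
Lemma coord_mul_spine (x y : evol_alg c) i :
  (forall k, coord x (spine a k) * coord y (spine a k) = 0) ->
  coord (amul x y) (spine a i) =
  \sum_j coord x (@leaf n a i j) * coord y (leaf j).
Proof.
move=> xy0; rewrite coordM.
under eq_bigr do rewrite cE mulrCA.
rewrite (sum_adj_spine (fun u => coord x u * coord y u * w u)).
rewrite big1 ?add0r => [|k _]; last by rewrite xy0 mul0r mulr0.
by apply: eq_bigr => j _; rewrite w_leaf mulr1.
Qed.

Lemma spine_coord_mul_eq0 (x y : evol_alg c) i :
  (forall j, coord (amul x y) (@leaf n a i j) = 0) ->
  coord x (spine a i) * coord y (spine a i) = 0.
Proof.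
move=> xy0; have /eqP := xy0 (Ordinal (nleaves_gt0 i)).
by rewrite coord_mul_leaf mulf_eq0 (negPf (w_neq0 _)) orbF => /eqP.
Qed.

Lemma spine_coord_sqr_eq0 (x : evol_alg c) i :
  (forall j, coord (amul x x) (@leaf n a i j) = 0) -> coord x (spine a i) = 0.
Proof. by move/spine_coord_mul_eq0/eqP; rewrite mulf_eq0 orbb => /eqP. Qed.

(** Reading [x x = 0] at the leaves kills the path coordinates of [x]; at a path vertex it then
    becomes a vanishing sum of squares over the leaves there. *)
Lemma mul_self_eq0 (x : evol_alg c) :
  (forall i : 'I_n, sum_squares_anisotropic K (nleaves a i.+1)) ->
  amul x x = 0 -> x = 0.
Proof.
move=> aniso xx0; have xs i : coord x (spine a i) = 0.
  by apply: spine_coord_sqr_eq0 => j; rewrite xx0 coord0.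
apply: coordP; apply: vertexP => [i|i j]; rewrite coord0 ?xs //.
apply: (aniso i (fun j => coord x (leaf j))).
have xxi := @coord_mul_spine x x i; rewrite xx0 coord0 in xxi.
by rewrite [RHS]xxi // => k; rewrite xs mul0r.
Qed.

End WeightedProduct.

(** * Images of the basis vectors under an injective homomorphism *)

Section Images.
Variables (K : fieldType) (n : nat) (a : nat -> nat).
Notation G := (caterpillar n a).
Variables (w : G -> K) (c : G -> G -> K).
Hypothesis cE : forall u v, c u v = (adj u v)%:R * w u.
Hypothesis w_neq0 : forall u, w u != 0.
Hypothesis w_leaf : forall i j, w (@leaf n a i j) = 1.
Hypothesis n_gt1 : (1 < n)%N.
Hypothesis a_gt1 : forall k, (2 <= k <= n)%N -> (1 < a k)%N.
Variable f : {linear graph_alg K G -> evol_alg c}.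
Hypothesis fM : alg_hom f.
Hypothesis f_inj : injective f.

Let nleaves_gt0 := nleaves_gt0 a_gt1.
Let nleaves_gt1 := nleaves_gt1 a_gt1.

Definition basis_image (u : G) : evol_alg c := f (evol_basis _ u).
Local Notation X := basis_image.

Let X_neq0 u : X u != 0.
Proof.
by rewrite -(linear0 f) (inj_eq f_inj) evol_basis_neq0.
Qed.

Let X_orth u v : u != v -> amul (X u) (X v) = 0.
Proof. by move=> uv; rewrite -fM evol_mul_basis_neq // linear0. Qed.

Let X_sqr u : amul (X u) (X u) = \sum_v (adj v u)%:R *: X v.
Proof.
rewrite -fM evol_mul_basis_sq linear_sum; apply: eq_bigr => v _.
by rewrite linearZ adj_sym.
Qed.

Let X_sqr_leaf i j : amul (X (@leaf n a i j)) (X (leaf j)) = X (spine a i).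
Proof.
apply: coordP => k; rewrite X_sqr coord_sum.
rewrite -(sum_adj_leaf (fun u => coord (X u) k) j).
by apply: eq_bigr => v _; rewrite coordZ.
Qed.

Let coord_X_sqr_spine i k :
  coord (amul (X (spine a i)) (X (spine a i))) k =
  \sum_j (adj (spine a j) (spine a i))%:R * coord (X (spine a j)) k
  + \sum_j coord (X (@leaf n a i j)) k.
Proof.
rewrite X_sqr coord_sum -(sum_adj_spine (fun u => coord (X u) k)).
by apply: eq_bigr => v _; rewrite coordZ.
Qed.

Let X_disjoint u v i :
  u != v -> coord (X u) (spine a i) * coord (X v) (spine a i) = 0.
Proof.
move/X_orth => uv0; apply: (spine_coord_mul_eq0 cE) => // j.
by rewrite uv0 coord0.
Qed.

(* The leaves [j] and [j'] have the same square, so [X (leaf j)] and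
   [X (leaf j')] have the same support on the path. *)
Let X_leaf_twin (i : 'I_n) (j j' : 'I_(nleaves a i.+1)) k :
  j != j' -> coord (X (leaf j)) (spine a k) = 0.
Proof.
move=> jj'.
have /eqP : coord (X (leaf j)) (spine a k) *
            coord (X (leaf j')) (spine a k) = 0.
  by apply: X_disjoint; rewrite (inj_eq (@leaf_inj n a i)).
rewrite mulf_eq0 => /orP[/eqP //|/eqP j'0].
apply: (spine_coord_sqr_eq0 cE) => // m.
by rewrite X_sqr_leaf -(X_sqr_leaf j') (coord_mul_leaf cE) j'0 !mul0r.
Qed.

Let X_leaf_off_first (i : 'I_n) j k :
  i != 0%N :> nat -> coord (X (@leaf n a i j)) (spine a k) = 0.
Proof.
move=> i0; pose j0 := Ordinal (nleaves_gt0 i).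
pose j1 := Ordinal (nleaves_gt1 i0).
case: (eqVneq j j0) => [->|]; last exact: X_leaf_twin.
exact: (@X_leaf_twin i j0 j1).
Qed.

(** [X_i] is the square of the image of a leaf at [i], and the leaf coordinates of a square involve
    only path coordinates of the factor. *)
Let X_spine_support i :
  (forall j k, coord (X (@leaf n a i j)) (spine a k) = 0) ->
  forall k j, coord (X (spine a i)) (@leaf n a k j) = 0.
Proof.
move=> Xl0 k j; rewrite -(X_sqr_leaf (Ordinal (nleaves_gt0 i))).
by rewrite (coord_mul_leaf cE) Xl0 !mul0r.
Qed.

Let X_spine_coord i :
  (forall j k, coord (X (@leaf n a i j)) (spine a k) = 0) ->
  exists k, coord (X (spine a i)) (spine a k) != 0.
Proof.
move/X_spine_support => Xi0; have [u] := neq0_coord (X_neq0 (spine a i)).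
by elim/vertexP: u => [k ?|k j]; [exists k|rewrite Xi0 eqxx].
Qed.

(** A choice of [s i] in the path support of each [X_i] is injective by disjointness, hence onto.
    Every path vertex is then taken by some [X_i], and none is left for a leaf. *)
Let X_leaf_spine_if i0 j0 k0 :
  (forall i, exists k, coord (X (spine a i)) (spine a k) != 0) ->
  coord (X (@leaf n a i0 j0)) (spine a k0) = 0.
Proof.
case/fin_all_exists => s sP; have s_inj : injective s.
  move=> i i' ss; apply/eqP; apply: contraT => ii'.
  have /eqP := @X_disjoint (spine a i) (spine a i') (s i) ii'.
  by rewrite mulf_eq0 (negPf (sP i)) {1}ss (negPf (sP i')).
have /codomP[i ->] := injF_onto s_inj k0.
have /eqP := @X_disjoint (leaf j0) (spine a i) (s i) isT.
by rewrite mulf_eq0 (negPf (sP i)) orbF => /eqP.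
Qed.

(** Ordinals 0 and 1 stand for the path vertices 1 and 2. The type of [l1] reduces to ['I_1]: it is
    the only leaf at vertex 1. *)
Let p1 : 'I_n := Ordinal (ltnW n_gt1).
Let p2 : 'I_n := Ordinal n_gt1.
Let l1 : 'I_(nleaves a p1.+1) := ord0.

Let X_leaf_spine i j k : coord (X (@leaf n a i j)) (spine a k) = 0.
Proof.
case: (eqVneq (i : nat) 0%N) => [i0|]; last exact: X_leaf_off_first.
have ip1 : i = p1 by apply: val_inj.
move: j; rewrite ip1 => {i i0 ip1} j; rewrite (ord1 j : j = l1) {j}.
apply/eqP; apply: contraT => Xk.
have [[k1 Xk1]|X10] : (exists k1, coord (X (spine a p1)) (spine a k1) != 0) \/
     forall k1, coord (X (spine a p1)) (spine a k1) = 0.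
- case: (pickP (fun k1 => coord (X (spine a p1)) (spine a k1) != 0)) => [k1|X0].
    by left; exists k1.
  by right=> k1; apply/eqP; rewrite -[_ == _]negbK X0.
- rewrite X_leaf_spine_if ?eqxx // in Xk => i.
  case: (eqVneq (i : nat) 0%N) => [i0|i0]; last first.
    by apply: X_spine_coord => *; apply: X_leaf_off_first.
  by exists k1; rewrite (_ : i = p1) //; apply: val_inj.
(* Here [X_1] has no path coordinate. Its square is read at a path vertex [k2] in the support of
   [X_2]: the left side vanishes because [X_(l1)] does at [k2], while the right side is the nonzero
   coordinate of [X_2]. *)
have [k2 Xk2] : exists k2, coord (X (spine a p2)) (spine a k2) != 0.
  by apply: X_spine_coord => *; apply: X_leaf_off_first.
have l1k2 : coord (X (leaf l1)) (spine a k2) = 0.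
  have /eqP := @X_disjoint (leaf l1) (spine a p2) k2 isT.
  by rewrite mulf_eq0 (negPf Xk2) orbF => /eqP.
have := coord_X_sqr_spine p1 (spine a k2).
rewrite (coord_mul_spine cE) // => [|k']; last by rewrite X10 mul0r.
rewrite big1 => [|j _]; last first.
  by rewrite -(X_sqr_leaf l1) (coord_mul_leaf cE) l1k2 !mul0r.
rewrite big_ord1 l1k2 addr0 (bigD1 p2) //= mul1r big1 ?addr0.
  by move=> X20; rewrite -X20 eqxx in Xk2.
move=> i ip2; case: (eqVneq i p1) => [->|ip1]; first by rewrite X10 mulr0.
have /eqP := @X_disjoint (spine a i) (spine a p2) k2 ip2.
by rewrite mulf_eq0 (negPf Xk2) orbF => /eqP ->; rewrite mulr0.
Qed.

Let X_spine_leaf i k j : coord (X (spine a i)) (@leaf n a k j) = 0.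
Proof. by apply: X_spine_support => *; apply: X_leaf_spine. Qed.

(** No leaf coordinate survives in [X_i]. With [s] injective, hence onto, every path vertex other
    than [s i] lies in the support of another image, so disjointness excludes it. *)
Lemma basis_image_spine :
  exists2 s : 'I_n -> 'I_n, injective s &
    (forall i, coord (X (spine a i)) (spine a (s i)) != 0) /\
    (forall i v, v != spine a (s i) -> coord (X (spine a i)) v = 0).
Proof.
have Xc i : exists k, coord (X (spine a i)) (spine a k) != 0.
  by apply: X_spine_coord => *; apply: X_leaf_spine.
case/fin_all_exists: Xc => s sP.
have X0 i i' : i != i' -> coord (X (spine a i)) (spine a (s i')) = 0.
  move=> ii'; have /eqP := @X_disjoint (spine a i) (spine a i') (s i') ii'.
  by rewrite mulf_eq0 (negPf (sP i')) orbF => /eqP.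
have s_inj : injective s.
  move=> i i' ss; apply/eqP; apply: contraT => /X0.
  by rewrite -ss => X0'; have := sP i; rewrite X0' eqxx.
exists s => //; split=> // i; elim/vertexP=> [k|k j _]; last exact: X_spine_leaf.
rewrite (inj_eq (@spine_inj n a)); have /codomP[i' ->] := injF_onto s_inj k.
by rewrite (inj_eq s_inj) eq_sym => /X0.
Qed.

Hypothesis f_surj : forall y, exists x, f x = y.

(* If [k] were another vertex, it would carry two leaves, whose orthogonal
   preimages would both have a nonzero coordinate at the only leaf of [p1]. *)
Let image_first k :
  coord (X (spine a p1)) (spine a k) != 0 ->
  (forall v, v != spine a k -> coord (X (spine a p1)) v = 0) -> k = p1.
Proof.
set lam := coord _ _ => lam0 X1; apply/eqP; apply: contraT => kp1.
have k0 : k != 0%N :> nat by [].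
pose m0 := Ordinal (nleaves_gt0 k); pose m1 := Ordinal (nleaves_gt1 k0).
have X1E : f (evol_basis _ (spine a p1)) = lam *: evol_basis c (spine a k).
  apply: coordP => v; rewrite coordZ coord_basis.
  by case: eqVneq => [->|/X1 Xv0]; rewrite ?mulr1 ?mulr0.
(* This puts the source algebra in weighted form, with all weights 1, so that the product formulas
   apply to preimages too. *)
have cAE (u v : G) : (adj u v)%:R = (adj u v)%:R * 1 :> K by rewrite mulr1.
have one0 (u : G) : 1 != 0 :> K by rewrite oner_eq0.
(* The leaf [m] squares to [e_k], and [f] sends [e_1] to [lam e_k]. *)
have sqrY (m : 'I_(nleaves a k.+1)) y : f y = evol_basis c (leaf m) ->
    lam *: amul y y = evol_basis _ (spine a p1).
  move=> fy; apply: f_inj; rewrite linearZ /= fM fy X1E; congr (_ *: _).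
  apply: coordP => v; rewrite evol_mul_basis_sq coord_sum coord_basis.
  rewrite -(sum_adj_leaf (fun u => (v == u)%:R) m).
  apply: eq_bigr => u _; rewrite coordZ coord_basis cE w_leaf mulr1.
  by rewrite adj_sym.
have Yspine (m : 'I_(nleaves a k.+1)) y i : f y = evol_basis c (leaf m) ->
    coord y (spine a i) = 0.
  move=> /sqrY yy; apply: (spine_coord_sqr_eq0 cAE) => // j.
  apply: (mulfI lam0); rewrite mulr0.
  by rewrite -coordZ yy coord_basis.
have Y1 (m : 'I_(nleaves a k.+1)) y : f y = evol_basis c (leaf m) ->
    coord y (leaf l1) != 0.
  move=> fy; have := congr1 (fun x => coord x (spine a p1)) (sqrY _ _ fy).
  rewrite /= coordZ (coord_mul_spine cAE) // => [|i]; last first.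
    by rewrite (Yspine _ _ _ fy) mul0r.
  rewrite big_ord1 coord_basis eqxx => yy; apply/eqP => y0.
  by move/eqP: yy; rewrite y0 mul0r mulr0 eq_sym oner_eq0.
have [y fy] := f_surj (evol_basis c (leaf m0)).
have [z fz] := f_surj (evol_basis c (leaf m1)).
have yz0 : amul y z = 0.
  apply: f_inj; rewrite fM fy fz linear0 evol_mul_basis_neq //.
  by rewrite (inj_eq (@leaf_inj n a k)).
have := congr1 (fun x => coord x (spine a p1)) yz0.
rewrite /= (coord_mul_spine cAE) // => [|i]; last first.
  by rewrite (Yspine _ _ _ fy) mul0r.
rewrite big_ord1 coord0 => /eqP; rewrite mulf_eq0.
by rewrite (negPf (Y1 _ _ fy)) (negPf (Y1 _ _ fz)).
Qed.

Lemma isomorphism_weights :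
  w (spine a p2) = 1 /\ (nleaves a 2)%:R * (1 - w (spine a p1)) = 0.
Proof.
have [s s_inj [sP X0]] := basis_image_spine.
have s1 : s p1 = p1 by apply: image_first; [apply: sP|apply: X0].
set lam1 := coord (X (spine a p1)) (spine a p1).
have lam1n0 : lam1 != 0 by have := sP p1; rewrite s1.
set nu := lam1 ^+ 2 * w (spine a p1).
have X1_sqr k : coord (amul (X (spine a p1)) (X (spine a p1))) k =
    (adj (spine a p1) k)%:R * nu.
  rewrite (@coord_sqr_single K G c (X (spine a p1)) (spine a p1)).
    by rewrite cE mulrCA.
  by move=> v v1; apply: X0; rewrite s1.
(* This reads [X_1^2] at [l1], where images of path vertices vanish. *)
have Xl1 : coord (X (leaf l1)) (leaf l1) = nu.
  have := coord_X_sqr_spine p1 (leaf l1); rewrite X1_sqr /= mul1r big_ord1.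
  by rewrite big1 ?add0r // => j _; rewrite X_spine_leaf mulr0.
have nu2 : nu ^+ 2 = lam1.
  rewrite /lam1 -(X_sqr_leaf l1) (coord_mul_spine cE) // => [|k].
    by rewrite big_ord1 Xl1.
  by rewrite X_leaf_spine mul0r.
have sum_adj_at i j : adj (spine a j) (spine a i) ->
    \sum_k (adj (spine a k) (spine a i))%:R *
      coord (X (spine a k)) (spine a (s j))
    = coord (X (spine a j)) (spine a (s j)).
  move=> ij; rewrite (bigD1 j) // ij mul1r big1 /= ?addr0 // => k kj.
  by rewrite X0 ?mulr0 // (inj_eq (@spine_inj n a)) (inj_eq s_inj) eq_sym.
(* This reads [X_1^2] at [s p2]. The right side is nonzero, so [s p2] is adjacent to vertex 1 and
   must be vertex 2. *)
have lam2 : (adj (spine a p1) (spine a (s p2)))%:R * nu =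
    coord (X (spine a p2)) (spine a (s p2)).
  rewrite -X1_sqr coord_X_sqr_spine sum_adj_at // [X in _ + X]big1 ?addr0 //.
have s2 : s p2 = p2.
  apply: val_inj; have := sP p2; rewrite -lam2 mulf_eq0 negb_or => /andP[+ _].
  case A: (adj _ _); last by rewrite eqxx.
  by move=> _; move: A; rewrite /= orbF => /eqP.
rewrite s2 /= mul1r in lam2.
have X2_sqr k : coord (amul (X (spine a p2)) (X (spine a p2))) k =
    (adj (spine a p2) k)%:R * (lam1 * w (spine a p2)).
  rewrite (@coord_sqr_single K G c (X (spine a p2)) (spine a p2)).
    by rewrite -lam2 nu2 cE mulrCA.
  by move=> v v2; apply: X0; rewrite s2.
(* This reads [X_2^2] at vertex 1, where only [X_1] contributes. *)
have w2 : lam1 * w (spine a p2) = lam1.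
  have := coord_X_sqr_spine p2 (spine a (s p1)).
  by rewrite X2_sqr sum_adj_at // s1 [X in _ + X]big1 //= mul1r addr0.
split; first by apply: (mulfI lam1n0); rewrite mulr1.
(* Let M be the square matrix of the leaf images at vertex 2, in coordinates at those leaves. Its
   columns sum to [lam1], and its rows are orthogonal with square [nu]. Summing all entries of M
   times its transpose in two ways gives [a_2 lam1^2 = a_2 nu]. *)
have Xsum (m : 'I_(nleaves a p2.+1)) :
    \sum_j coord (X (@leaf n a p2 j)) (leaf m) = lam1.
  have := coord_X_sqr_spine p2 (leaf m).
  rewrite X2_sqr /= mul1r w2 [X in X + _]big1 ?add0r // => j _.
  by rewrite X_spine_leaf mulr0.
have Xdot j : \sum_j' \sum_m coord (X (@leaf n a p2 j)) (@leaf n a p2 m)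
    * coord (X (@leaf n a p2 j')) (@leaf n a p2 m) = nu.
  rewrite (bigD1 j) //= [X in _ + X]big1 ?addr0 => [|j' jj'].
    rewrite lam2 -(X_sqr_leaf j) (coord_mul_spine cE) // => k.
    by rewrite X_leaf_spine mul0r.
  transitivity (coord (amul (X (leaf j)) (X (@leaf n a p2 j'))) (spine a p2)).
    by rewrite (coord_mul_spine cE) // => k; rewrite X_leaf_spine mul0r.
  by rewrite X_orth ?coord0 // (inj_eq (@leaf_inj n a p2)) eq_sym.
have : \sum_(m < nleaves a p2.+1) lam1 ^+ 2 = \sum_(m < nleaves a p2.+1) nu.
  under [RHS]eq_bigr => j _ do rewrite -(Xdot j).
  under [RHS]eq_bigr do rewrite exchange_big /=.
  rewrite exchange_big; apply: eq_bigr => m _.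
  rewrite -(Xsum m) expr2 mulr_suml; apply: eq_bigr => j _.
  by rewrite mulr_sumr.
rewrite !sumr_const card_ord => sum_eq; apply: (mulfI (expf_neq0 2 lam1n0)).
by rewrite mulr0 mulrCA mulrBr mulr1 -/nu mulr_natl mulrnBl sum_eq subrr.
Qed.

End Images.

(** * Homomorphisms into an algebra where only 0 squares to 0 *)

Section Anisotropy.
Variables (K : fieldType) (G : sgraph) (c : G -> G -> K).
Hypothesis c_adj : forall u v, adj u v -> c u v != 0.
Variable B : algebra K.
Hypothesis mul_self_eq0 : forall x : B, amul x x = 0 -> x = 0.
Variable f : {linear evol_alg c -> B}.
Hypothesis fM : alg_hom f.

Let amul0r (x : B) : amul x 0 = 0.
Proof.
by have := amul_linearr x (-1) 0 0; rewrite scaleN1r oppr0 addr0 scaleN1r addNr.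
Qed.

Let amul_combr (x : B) (y : G -> K) (z : G -> B) :
  amul x (\sum_v y v *: z v) = \sum_v y v *: amul x (z v).
Proof.
pose L := HB.pack_for {linear B -> B} (amul x)
  (GRing.isLinear.Build K B B _ (amul x) (amul_linearr x)).
rewrite -[amul x]/(L : B -> B) linear_sum.
by apply: eq_bigr => v _; rewrite linearZ.
Qed.

Let b := evol_basis c.

(** Orthogonality of the images isolates one coefficient; this serves both propagation along edges
    and linear independence. *)
Let image_comb (y : G -> K) u :
  amul (f (b u)) (\sum_v y v *: f (b v)) = y u *: amul (f (b u)) (f (b u)).
Proof.
rewrite amul_combr (bigD1 u) //= big1 ?addr0 // => v vu.
by rewrite -fM evol_mul_basis_neq 1?eq_sym // linear0 scaler0.
Qed.

Let image_decomp x : f x = \sum_v coord x v *: f (b v).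
Proof.
rewrite {1}(evol_basis_decomp x) linear_sum.
by apply: eq_bigr => v _; rewrite linearZ.
Qed.

(** Multiplying [f (e_u^2) = 0] by [f (e_v)] leaves [c u v] times the square of [f (e_v)]. *)
Let kernel_adj u v : adj u v -> f (b u) = 0 -> f (b v) = 0.
Proof.
move=> uv fu0; apply: mul_self_eq0; apply: (scalerI (c_adj uv)).
rewrite scaler0 -(image_comb (c u)).
have -> : \sum_k c u k *: f (b k) = amul (f (b u)) (f (b u)).
  rewrite -fM evol_mul_basis_sq linear_sum.
  by apply: eq_bigr => k _; rewrite linearZ.
by rewrite fu0 !amul0r.
Qed.

(** One vanishing basis image spreads to all vertices by connectedness. If there is none,
    multiplying [f x = 0] by [f (e_u)] kills the coordinate of [x] at [u]. *)
Lemma alg_hom_eq0_or_inj : (forall x, f x = 0) \/ injective f.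
Proof.
case: (pickP (fun u => f (b u) == 0)) => [u /eqP fu0|fn0]; [left|right].
  have f0 v : f (b v) = 0.
    have /connectP[p pth ->] := adj_conn u v.
    elim: p u fu0 pth => //= v' p IH u fu0 /andP[uv' /IH]; apply.
    exact: kernel_adj fu0.
  by move=> x; rewrite image_decomp big1 // => v _; rewrite f0 scaler0.
apply: raddf_inj => x fx0; apply: coordP => u; rewrite coord0.
have /eqP : amul (f (b u)) (f x) = 0 by rewrite fx0 amul0r.
rewrite (image_decomp x) image_comb scaler_eq0.
case/orP=> [/eqP //|/eqP /mul_self_eq0 fu0].
by have := fn0 u; rewrite fu0 eqxx.
Qed.

End Anisotropy.

(** * From injective homomorphisms to the theorem *)

(** Both algebras have the same finite-dimensional underlying space, so [f] is an injective
    endomorphism of it. *)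
Lemma evol_injective_bij (K : fieldType) (T : finType) (c d : T -> T -> K)
    (f : {linear evol_alg c -> evol_alg d}) : injective f -> bijective f.
Proof.
move=> f_inj; pose V : vectType K := {ffun T -> K^o}.
pose h : {linear V -> V} := f.
have ker0 : lker (linfun h) == 0%VS.
  by apply/lker0P => x y; rewrite !lfunE => /f_inj.
exists ((linfun h)^-1)%VF => x.
  by have := lker0_lfunK ker0 x; rewrite lfunE.
by have := lker0_lfunVK ker0 x; rewrite lfunE.
Qed.

Lemma isomorphic_sym (K : fieldType) (A B : algebra K) :
  isomorphic A B -> isomorphic B A.
Proof.
case=> f [fM [g fK gK]].
pose h := HB.pack_for {linear B -> A} g
  (GRing.isLinear.Build K B A _ g (can2_linear fK gK)).
exists h; split; last by exists f.
by move=> x y; apply: (can_inj fK); rewrite fM !gK.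
Qed.

(** Vertex 1 has degree 2 and vertex 2, lying between 1 and 3, has degree [a 2 + 2]. Whichever
    factor of [a 2 * (1 - 1/2)] vanishes in [K], it follows that 2 = 1. *)
Lemma graph_rw_not_isomorphic (K : fieldType) (n : nat) (a : nat -> nat) :
  (3 <= n)%N -> (forall k, (2 <= k <= n)%N -> (1 < a k)%N) ->
  (forall i : caterpillar n a, (deg i)%:R != 0 :> K) ->
  ~ isomorphic (graph_alg K (caterpillar n a)) (rw_alg K (caterpillar n a)).
Proof.
move=> hn ha hdeg [f [fM [g fK gK]]].
have n_gt1 : (1 < n)%N by apply: leq_trans hn.
pose w (u : caterpillar n a) : K := (deg u)%:R^-1.
have w_neq0 u : w u != 0 by rewrite invr_eq0.
have w_leaf i j : w (@leaf n a i j) = 1 by rewrite /w deg_leaf invr1.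
have f_surj y : exists x, f x = y by exists (g y).
have [] := isomorphism_weights (fun u v => erefl) w_neq0 w_leaf n_gt1 ha fM
  (can_inj fK) f_surj.
set p1 := Ordinal (ltnW n_gt1); set p2 := Ordinal n_gt1; set p3 := Ordinal hn.
rewrite /w => d2; have deg1 : deg (spine a p1) = 2%N.
  rewrite deg_spine (bigD1 p2) //= big1 // => k; rewrite -val_eqE /= eq_sym.
  by move/negPf->.
have deg2 : deg (spine a p2) = (2 + a 2)%N.
  rewrite deg_spine (bigD1 p1) //= (bigD1 p3) //= big1 // => k /andP[].
  rewrite -!val_eqE /= eqSS => /negPf -> ; rewrite eq_sym.
  by move/negPf->.
have /(congr1 (fun x => x^-1)) := d2; rewrite invrK invr1 deg2 natrD.
have two0 : 2%:R != 0 :> K by rewrite -deg1.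
have two1 : 2%:R != 1 :> K by rewrite -subr_eq0 mulr2n addrK oner_neq0.
rewrite deg1 /nleaves /= => d2E /eqP; rewrite mulf_eq0 => /orP[/eqP a20|].
  by move/eqP: d2E; rewrite a20 addr0 (negPf two1).
by rewrite subr_eq0 eq_sym invr_eq1 (negPf two1).
Qed.

Theorem proposition3p2 (K : fieldType) (n : nat) (a : nat -> nat)
    (hn : (3 <= n)%N)
    (ha : forall k : nat, (2 <= k <= n)%N -> (1 < a k)%N)
    (hdeg : forall i : caterpillar n a, (deg i)%:R != 0 :> K) :
  ~ isomorphic (graph_alg K (caterpillar n a)) (rw_alg K (caterpillar n a))
  /\
  ((forall k : nat, (2 <= k <= n)%N -> sum_squares_anisotropic K (a k)) ->
   (forall f : {linear graph_alg K (caterpillar n a)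
                       -> rw_alg K (caterpillar n a)},
      alg_hom f <-> forall x, f x = 0)
   /\
   (forall g : {linear rw_alg K (caterpillar n a)
                       -> graph_alg K (caterpillar n a)},
      alg_hom g <-> forall x, g x = 0)).
Proof.
have niso := graph_rw_not_isomorphic hn ha hdeg.
split=> // aniso.
(* The single leaf at vertex 1 gives one square, which vanishes only at 0; [aniso] covers the other
   vertices. *)
have leaf_aniso (i : 'I_n) : sum_squares_anisotropic K (nleaves a i.+1).
  rewrite /nleaves eqSS; case: (eqVneq (i : nat) 0%N) => [_|i0].
    move=> x; rewrite big_ord1 => /eqP; rewrite expf_eq0 /= => /eqP x0 j.
    by rewrite (ord1 j).
  by apply: aniso; rewrite ltn_ord andbT ltnS lt0n.
have lgt0 := nleaves_gt0 ha.
have hom0 (c d : caterpillar n a -> caterpillar n a -> K)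
    (f : {linear evol_alg c -> evol_alg d}) : (forall x, f x = 0) -> alg_hom f.
  move=> f0 x y; rewrite !f0; apply: coordP => k.
  by rewrite coord0 coordM big1 // => u _; rewrite coord0 !mul0r.
split=> f; split=> [fM|/hom0//].
  have [|x xx0|//|f_inj] := alg_hom_eq0_or_inj _ _ fM.
  - by move=> u v ->; rewrite oner_eq0.
  - apply: (mul_self_eq0 (w := fun u => (deg u)%:R^-1)) xx0 => // [u|i j].
      by rewrite invr_eq0.
    by rewrite deg_leaf invr1.
  by case: niso; exists f; split=> //; apply: evol_injective_bij.
have [u v uv|x xx0|//|f_inj] := alg_hom_eq0_or_inj _ _ fM.
- by rewrite uv mul1r invr_eq0.
- apply: (mul_self_eq0 (w := fun=> 1)) xx0 => // [u v|u].
    by rewrite mulr1.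
  by rewrite oner_eq0.
case: niso; apply: isomorphic_sym; exists f; split=> //.
exact: evol_injective_bij.
Qed.
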